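(* Let $M$ be an $n$-dimensional smooth manifold and let $HM$ be a parallelizable distribution on $M$ of rank $k<n$ with parallelization sections $X_1,\dots,X_k$. Let $\Omega_1,\dots,\Omega_k$ be the associated parallelization forms and put $g:=\sum_{i=1}^k\Omega_i\otimes\Omega_i$. If $HM$ is non-integrable, then $(HM,X_i)$ defines a sub-Riemannian structure on $M$, with sub-Riemannian metric $g$.
   Context: A distribution of rank $k$ on $M$ is a map $D$ assigning to each $p\in M$ a $k$-dimensional subspace $D_p$ of $T_pM$; it may be regarded as a vector subbundle of $TM$. All distributions are assumed differentiable: every point has a neighborhood $U$ with smooth vector fields $Y_1,\dots,Y_k$ on $U$ such that $Y_1(q),\dots,Y_k(q)$ form a basis of $D_q$ for all $q\in U$. $\Gamma(D)$ denotes the $C^\infty(M)$-module of smooth sections of $D$. $D$ is integrable if it admits a unique maximal integral manifold through each point of $M$ (equivalently, by the Frobenius theorem, $D$ is involutive: $[X,Y]\in D$ for all $X,Y\in D$). $D$ is bracket generating if there is an integer $r\ge 1$ such that $D^r_p=T_pM$ for all $p\in M$, where $D^1_p=D_p$ and $D^{s+1}_p=D^s_p+[D_p,D^s_p]$ for $s\ge 1$, with $[D_p,D^s_p]=\{[X,Y]: X\in D_p,\ Y\in D^s_p\}$. A distribution $HM$ of rank $k<n$ is parallelizable if it admits $k$ independent global smooth sections $X_1,\dots,X_k\in\Gamma(HM)$, called parallelization sections; consequently $HM=\mathrm{span}\{X_1,\dots,X_k\}$. It is denoted $(HM,X_i)$. The parallelization forms are the differential 1-forms $\Omega_i:\Gamma(HM)\to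 C^\infty(M)$ defined by $\Omega_i(X_j)=\delta_{ij}$. A sub-Riemannian metric on a distribution $D$ is a map $g$ assigning to each $p\in M$ a positive definite inner product $g_p:D_p\times D_p\to\mathbb{R}$, varying smoothly with $p$. A sub-Riemannian structure on $M$ is a pair $(D,g)$ where $D$ is a non-integrable (bracket generating) distribution on $M$ and $g$ is a smooth sub-Riemannian metric on $D$. *)

(* Defs.v *)
From HB Require Import structures.
From mathcomp Require Import all_boot all_order all_algebra.
From mathcomp Require Import all_classical all_reals all_analysis.

Set Implicit Arguments.
Unset Strict Implicit.
Unset Printing Implicit Defensive.

Import Order.TTheory GRing.Theory Num.Theory.
Import numFieldNormedType.Exports.

Local Open Scope classical_set_scope.
Local Open Scope ring_scope.

(* Meant for open [U]; only the values of [f] on [U] matter then. *)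
Fixpoint Ck (R : realType) (n r : nat) (U : set 'rV[R]_n)
    (f : 'rV[R]_n -> R) : Prop :=
  (forall x, U x -> {for x, continuous f}) /\
  if r is r'.+1 then
    forall i : 'I_n, (forall x, U x -> derivable f x 'e_i) /\ Ck r' U ('D_'e_i f)
  else True.

Definition Csmooth (R : realType) (n : nat) (U : set 'rV[R]_n)
    (f : 'rV[R]_n -> R) : Prop :=
  forall r, Ck r U f.

Record chart (R : realType) (n : nat) (T : topologicalType) := Chart {
  cdom : set T;
  cmap : T -> 'rV[R]_n;
  cinv : 'rV[R]_n -> T;
  cdom_open : open cdom;
  cimg_open : open (cmap @` cdom);
  cmapK : forall p, cdom p -> cinv (cmap p) = p;
  cmap_continuous : forall p, cdom p -> {for p, continuous cmap};
  cinv_continuous :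
    forall x, (cmap @` cdom) x -> {for x, continuous cinv} }.

Record manifold (R : realType) (n : nat) := Manifold {
  mcarrier :> topologicalType;
  atlas : set (chart R n mcarrier);
  manifold_hausdorff : hausdorff_space mcarrier;
  manifold_second_countable : @second_countable mcarrier;
  atlas_cover : forall p, exists2 c, atlas c & cdom c p;
  atlas_compatible : forall c c', atlas c -> atlas c' -> forall j : 'I_n,
    Csmooth (cmap c @` (cdom c `&` cdom c'))
            (fun x => cmap c' (cinv c x) 0 j) }.

(* For open [U]. *)
Definition smooth_on (R : realType) (n : nat) (M : manifold R n)
    (U : set M) (f : M -> R) : Prop :=
  forall c, atlas c -> Csmooth (cmap c @` (cdom c `&` U)) (f \o cinv c).

Definition smooth_pred (R : realType) (n : nat) (M : manifold R n) :
    {pred M -> R} :=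
  mem [set f : M -> R | smooth_on setT f].
Arguments smooth_pred {R n} M _.

Record Cinf (R : realType) (n : nat) (M : manifold R n) := MkCinf {
  Cinf_val :> M -> R;
  Cinf_smooth : Cinf_val \in smooth_pred M }.

HB.instance Definition _ (R : realType) (n : nat) (M : manifold R n) :=
  [isSub for @Cinf_val R n M].
HB.instance Definition _ (R : realType) (n : nat) (M : manifold R n) :=
  [Choice of Cinf M by <:].

Lemma Ck_cont (R : realType) (n r : nat) (U : set 'rV[R]_n) (f : 'rV[R]_n -> R) :
  Ck r U f -> forall x, U x -> {for x, continuous f}.
Proof. by case: r => [|r] []. Qed.

Lemma CkS (R : realType) (n r : nat) (U : set 'rV[R]_n) (f : 'rV[R]_n -> R) :
  Ck r.+1 U f -> Ck r U f.
Proof.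
elim: r f => [|r IH] f [cf df]; first by [].
by split=> // i; have [df1 df2] := df i; split=> //; apply: IH.
Qed.

Lemma eq_Ck (R : realType) (n r : nat) (U : set 'rV[R]_n)
    (f g : 'rV[R]_n -> R) :
  open U -> (forall x, U x -> f x = g x) -> Ck r U f -> Ck r U g.
Proof.
move=> oU.
have nfg (f1 g1 : 'rV[R]_n -> R) : (forall x, U x -> f1 x = g1 x) ->
    forall x, U x -> \forall y \near x, f1 y = g1 y.
  by move=> fg x Ux; apply: filterS (open_nbhs_nbhs (conj oU Ux)).
have cont (f1 g1 : 'rV[R]_n -> R) : (forall x, U x -> f1 x = g1 x) ->
    (forall x, U x -> {for x, continuous f1}) ->
    forall x, U x -> {for x, continuous g1}.
  move=> fg cf x Ux; rewrite /prop_for /continuous_at -(fg _ Ux).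
  apply: cvg_trans (cf _ Ux); apply: (@near_eq_cvg _ _ _ (nbhs_filter x)).
  exact: nfg fg _ Ux.
elim: r f g => [|r IH] f g fg [cf df]; split=> //; try exact: cont fg cf.
move=> i; have [df1 df2] := df i; split=> [x Ux|].
  by apply: near_eq_derivable (df1 _ Ux); exact: nfg.
by apply: IH df2 => x Ux; apply: near_eq_derive; exact: nfg.
Qed.

Lemma Ck_cst (R : realType) (n r : nat) (U : set 'rV[R]_n) (a : R) :
  Ck r U (cst a).
Proof.
elim: r a => [|r IH] a; split=> //; try by move=> x _; exact: cst_continuous.
move=> i; split=> [x _|]; first exact: derivable_cst.
by rewrite (_ : 'D_'e_i _ = cst 0) //; apply/funext => x; rewrite derive_cst.
Qed.

Lemma CkD (R : realType) (n r : nat) (U : set 'rV[R]_n) (f g : 'rV[R]_n -> R) :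
  open U -> Ck r U f -> Ck r U g -> Ck r U (f + g).
Proof.
move=> oU; elim: r f g => [|r IH] f g [cf df] [cg dg].
all: split=> //; try by
  move=> x Ux; apply: (@continuousD _ R^o); [exact: cf|exact: cg].
move=> i; have [df1 df2] := df i; have [dg1 dg2] := dg i; split=> [x Ux|].
  by apply: derivableD; [exact: df1|exact: dg1].
by apply: eq_Ck (IH _ _ df2 dg2) => // x Ux; rewrite deriveD//; [exact: df1|exact: dg1].
Qed.

Lemma CkM (R : realType) (n r : nat) (U : set 'rV[R]_n) (f g : 'rV[R]_n -> R) :
  open U -> Ck r U f -> Ck r U g -> Ck r U (f * g).
Proof.
move=> oU; elim: r f g => [|r IH] f g Cf Cg.
all: have [cf df] := Cf; have [cg dg] := Cg; split=> //; try by
  move=> x Ux; apply: continuousM; [exact: cf|exact: cg].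
move=> i; have [df1 df2] := df i; have [dg1 dg2] := dg i; split=> [x Ux|].
  by apply: derivableM; [exact: df1|exact: dg1].
apply: (@eq_Ck _ _ _ _ (f * 'D_'e_i g + g * 'D_'e_i f)) => //.
  by move=> x Ux; rewrite deriveM//; [exact: df1|exact: dg1].
by apply: CkD => //; apply: IH => //; exact: CkS.
Qed.

Lemma chart_open (R : realType) (n : nat) (M : manifold R n) (c : chart R n M)
    (U : set M) :
  open U -> open (cmap c @` (cdom c `&` U)).
Proof.
move=> oU; rewrite openE => x [p [cp Up] px].
have ix : (cmap c @` cdom c) x by exists p.
have xp : cinv c x = p by rewrite -px cmapK.
have h1 := open_nbhs_nbhs (conj (@cimg_open _ _ _ c) ix).
have h2 : nbhs x (cinv c @^-1` U).
  by apply: (cinv_continuous ix); rewrite xp; apply: open_nbhs_nbhs.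
apply: filterS (filterI h1 h2) => y [[q cq qy]] /=.
by rewrite -qy cmapK // => Uq; exists q.
Qed.

Lemma smooth_subring (R : realType) (n : nat) (M : manifold R n) :
  subring_closed (smooth_pred M).
Proof.
have cO (c : chart R n M) := @chart_open R n M c setT openT.
split=> [|f g|f g]; rewrite !inE /=.
- by move=> c _ r; exact: Ck_cst.
- move=> sf sg c ac r.
  rewrite (_ : _ \o _ = f \o cinv c + (cst (-1)) * (g \o cinv c)); last first.
    by apply/funext => x; rewrite -[RHS]/(f (cinv c x) + -1 * g (cinv c x)) mulN1r.
  apply: CkD => //; first exact: sf.
  by apply: CkM => //; [exact: Ck_cst|exact: sg].
- by move=> sf sg c ac r; apply: CkM => //; [exact: sf|exact: sg].
Qed.

Lemma smooth_submod (R : realType) (n : nat) (M : manifold R n) :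
  GRing.subsemimod_closed (smooth_pred M).
Proof.
have [_ _ SM] := @smooth_subring R n M.
have [S0 SD] := GRing.subring_closedB (@smooth_subring R n M).
split; first split=> // [f g Sf Sg].
  by rewrite -[g]opprK; apply: (SD _ _ Sf); rewrite -sub0r; exact: SD.
move=> a f Sf; rewrite (_ : a *: f = cst a * f) //; apply: SM => //.
by rewrite inE /= => c _ r; exact: Ck_cst.
Qed.

HB.instance Definition _ (R : realType) (n : nat) (M : manifold R n) :=
  GRing.SubChoice_isSubComPzRing.Build (M -> R) (smooth_pred M) (Cinf M)
    (@smooth_subring R n M).
HB.instance Definition _ (R : realType) (n : nat) (M : manifold R n) :=
  GRing.SubZmodule_isSubLmodule.Build R (M -> R) (smooth_pred M) (Cinf M)
    (@smooth_submod R n M).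

(* The element [f] of C^oo(M); junk value 0 if [f] is not smooth. *)
Definition to_Cinf (R : realType) (n : nat) (M : manifold R n)
    (f : M -> R) : Cinf M :=
  insubd 0 f.

(* T_pM is realised as the space of derivations of C^oo(M) at p, inside the
   R-vector space of all functions from C^oo(M) to R.  Vector fields and
   distributions are thus maps into a fixed space, constrained pointwise. *)
Definition tvec (R : realType) (n : nat) (M : manifold R n) : Type :=
  Cinf M -> R.
HB.instance Definition _ (R : realType) (n : nat) (M : manifold R n) :=
  GRing.Lmodule.copy (tvec M) (Cinf M -> R).

Definition tangent (R : realType) (n : nat) (M : manifold R n) (p : M) :
    set (tvec M) :=
  [set v | (forall (a : R) (f g : Cinf M), v (a *: f + g) = a * v f + v g) /\
           (forall f g : Cinf M, v (f * g) = v f * g p + f p * v g)].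

Definition vfield (R : realType) (n : nat) (M : manifold R n) : Type :=
  M -> tvec M.
HB.instance Definition _ (R : realType) (n : nat) (M : manifold R n) :=
  GRing.Lmodule.copy (vfield M) (M -> tvec M).

Definition smooth_vfield_on (R : realType) (n : nat) (M : manifold R n)
    (U : set M) (Y : vfield M) : Prop :=
  (forall p, U p -> tangent p (Y p)) /\
  (forall f : Cinf M, smooth_on U (fun p => Y p f)).

(* Y f, for a smooth vector field Y *)
Definition vf_app (R : realType) (n : nat) (M : manifold R n)
    (Y : vfield M) (f : Cinf M) : Cinf M :=
  to_Cinf (fun p => Y p f).

Definition lie_bracket (R : realType) (n : nat) (M : manifold R n)
    (X Y : vfield M) : vfield M :=
  fun p f => X p (vf_app Y f) - Y p (vf_app X f).

Definition lin_indep (R : realType) (V : lmodType R) (k : nat)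
    (e : 'I_k -> V) : Prop :=
  forall a : 'I_k -> R, \sum_i a i *: e i = 0 -> forall i, a i = 0.

Definition basis_of_set (R : realType) (V : lmodType R) (k : nat)
    (W : set V) (e : 'I_k -> V) : Prop :=
  lin_indep e /\ W = [set v | exists a : 'I_k -> R, v = \sum_i a i *: e i].

(* D p, a subset of T_pM, for every p *)
Definition fiber_family (R : realType) (n : nat) (M : manifold R n) : Type :=
  M -> set (tvec M).

Definition rank_distribution (R : realType) (n : nat) (M : manifold R n) (k : nat)
    (D : fiber_family M) : Prop :=
  (forall p, D p `<=` tangent p /\
             exists e : 'I_k -> tvec M, basis_of_set (D p) e) /\
  (forall p, exists U : set M, [/\ open U, U p &
     exists Y : 'I_k -> vfield M,
       (forall i, smooth_vfield_on U (Y i)) /\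
       (forall q, U q -> basis_of_set (D q) (fun i => Y i q))]).

Definition sections_on (R : realType) (n : nat) (M : manifold R n)
    (U : set M) (D : fiber_family M) : set (vfield M) :=
  [set Y | smooth_vfield_on U Y /\ forall p, U p -> D p (Y p)].

Definition smooth_map (R : realType) (m n : nat) (N : manifold R m)
    (M : manifold R n) (h : N -> M) : Prop :=
  continuous h /\
  forall c c', atlas c -> atlas c' -> forall j : 'I_n,
    Csmooth (cmap c @` (cdom c `&` h @^-1` cdom c'))
            (fun x => cmap c' (h (cinv c x)) 0 j).

Definition pushforward (R : realType) (m n : nat) (N : manifold R m)
    (M : manifold R n) (h : N -> M) (v : tvec N) : tvec M :=
  fun f => v (to_Cinf (f \o h)).

(* S is the image of an injective immersion of a connected k-manifold: for D of
   rank k, the condition on tangent spaces forces the differential to be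
   injective. *)
Definition integral_manifold (R : realType) (n : nat) (M : manifold R n)
    (k : nat) (D : fiber_family M) (S : set M) : Prop :=
  exists (N : manifold R k) (h : N -> M),
    [/\ connected [set: N], injective h, smooth_map h, range h = S &
        forall q, pushforward h @` tangent q = D (h q)].

Definition maximal_integral_manifold (R : realType) (n : nat)
    (M : manifold R n) (k : nat) (D : fiber_family M) (S : set M) : Prop :=
  integral_manifold k D S /\
  forall S', integral_manifold k D S' -> S `<=` S' -> S' = S.

Definition integrable_distribution (R : realType) (n : nat) (M : manifold R n) (k : nat)
    (D : fiber_family M) : Prop :=
  forall p, exists! S, maximal_integral_manifold k D S /\ S p.

Definition nonintegrable (R : realType) (n : nat) (M : manifold R n) (k : nat)
    (D : fiber_family M) : Prop :=
  ~ integrable_distribution k D.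

(* [bracket_module D s] is the module of vector fields D^(s+1) generated by
   D^(s) and [D, D^(s)]; its fibre at p is the set of the values at p.  Global
   sections suffice: local ones can be multiplied by bump functions. *)
Fixpoint bracket_module (R : realType) (n : nat) (M : manifold R n)
    (D : fiber_family M) (s : nat) : set (vfield M) :=
  if s is s'.+1 then
    [set Z | exists (m : nat) (Y : vfield M) (A B : 'I_m -> vfield M),
       [/\ bracket_module D s' Y,
           forall j, sections_on setT D (A j),
           forall j, bracket_module D s' (B j) &
           Z = Y + \sum_j lie_bracket (A j) (B j)]]
  else sections_on setT D.

Definition bracket_generating (R : realType) (n : nat) (M : manifold R n)
    (D : fiber_family M) : Prop :=
  exists s, forall p, [set Z p | Z in bracket_module D s] = tangent p.

Definition linear_on (R : realType) (V : lmodType R) (W : set V)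
    (w : V -> R) : Prop :=
  forall (a : R) (u v : V), W u -> W v -> w (a *: u + v) = a * w u + w v.

Definition inner_product_on (R : realType) (V : lmodType R) (W : set V)
    (b : V -> V -> R) : Prop :=
  [/\ forall v, W v -> linear_on W (fun u => b u v),
      forall u v, W u -> W v -> b u v = b v u &
      forall u, W u -> u <> 0 -> 0 < b u u].

Definition sub_riemannian_metric (R : realType) (n : nat) (M : manifold R n)
    (D : fiber_family M) (g : M -> tvec M -> tvec M -> R) : Prop :=
  (forall p, inner_product_on (D p) (g p)) /\
  (forall (U : set M) (Y Z : vfield M), open U ->
     sections_on U D Y -> sections_on U D Z ->
     smooth_on U (fun p => g p (Y p) (Z p))).

(* "Non-integrable" is used both for [nonintegrable] and for
   [bracket_generating], which are not equivalent (the latter is stronger in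
   general); [nonint] is the meaning in force. *)
Definition sub_riemannian_structure (R : realType) (n : nat)
    (M : manifold R n) (nonint : fiber_family M -> Prop) (k : nat)
    (D : fiber_family M) (g : M -> tvec M -> tvec M -> R) : Prop :=
  [/\ rank_distribution k D, nonint D & sub_riemannian_metric D g].

Definition parallelization (R : realType) (n : nat) (M : manifold R n)
    (k : nat) (D : fiber_family M) (X : 'I_k -> vfield M) : Prop :=
  (forall i, sections_on setT D (X i)) /\
  (forall p, lin_indep (fun i => X i p)).

(* A 1-form Gamma(D) -> C^oo(M) is given fibrewise by a covector on each D p.
   Duality determines these covectors on a parallelized D, so that they exist,
   and vary smoothly, without any further requirement. *)
Definition parallelization_forms (R : realType) (n : nat) (M : manifold R n)
    (k : nat) (D : fiber_family M) (X : 'I_k -> vfield M)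
    (Omega : 'I_k -> M -> tvec M -> R) : Prop :=
  forall i p, linear_on (D p) (Omega i p) /\
              forall j, Omega i p (X j p) = (i == j)%:R.

(* \sum_i Omega_i \otimes Omega_i *)
Definition sum_tensor_sq (R : realType) (n : nat) (M : manifold R n)
    (k : nat) (Omega : 'I_k -> M -> tvec M -> R)
    (p : M) (u v : tvec M) : R :=
  \sum_i Omega i p u * Omega i p v.

(* Main.v *)
Require Import Defs.
From mathcomp Require Import all_boot all_order all_algebra perm.
From mathcomp Require Import all_classical all_reals all_analysis.

(** Being a distribution of rank [k] and being non-integrable, in either sense
    of the word, are hypotheses, so the content is that
    [g = \sum_i Omega_i * Omega_i] is a sub-Riemannian metric.

    On a fibre [D p] the [X_i p] form a basis ([parallelization_basis]) and
    [Omega_i] reads off the i-th coordinate, so [g p] is the Euclidean inner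
    product in these coordinates ([sum_tensor_sq_inner]).

    For the smoothness of [g] it suffices that the coordinates
    [y_i = Omega_i Y] of a section [Y] over an open set are smooth
    ([smooth_parallelization_form]).  Tangent vectors are functions on the ring
    of smooth functions, and the [X_i] are independent at a given point [p0];
    so there are smooth functions [s_1, ..., s_k] for which the matrix
    [A = (X_j s_l)] is invertible at [p0] ([lin_indep_det]), hence near [p0].
    There the relations [Y s_l = \sum_j y_j * X_j s_l] form a linear system with
    smooth coefficients and smooth right-hand sides, and Cramer's rule shows
    that its solution [y] is smooth ([Ck_solve]).  The [s_l] are global
    functions, so bump functions are not needed. *)

Set Implicit Arguments.
Unset Strict Implicit.
Unset Printing Implicit Defensive.

Import Order.TTheory GRing.Theory Num.Theory.
Import numFieldNormedType.Exports.

Local Open Scope classical_set_scope.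
Local Open Scope ring_scope.

(** * Functions of class C^k *)

(** The neighbourhoods [V] need not be open: [Ck r V f] constrains
    the partial derivatives of [f], a function on the whole space, at the
    points of [V], and not those of a restriction of [f]. *)
Lemma Ck_local (R : realType) (n r : nat) (U : set 'rV[R]_n)
    (f : 'rV[R]_n -> R) :
  (forall x, U x -> exists2 V, V x & Ck r V f) -> Ck r U f.
Proof.
elim: r f => [|r IH] f loc; split=> //.
- by move=> x /loc[V Vx [cf _]]; exact: cf.
- by move=> x /loc[V Vx [cf _]]; exact: cf.
move=> i; split=> [x /loc[V Vx [_ df]]|].
  by case: (df i) => d _; exact: d.
by apply: IH => x /loc[V Vx [_ df]]; exists V => //; case: (df i).
Qed.

Lemma Ck_subset (R : realType) (n r : nat) (U V : set 'rV[R]_n)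
    (f : 'rV[R]_n -> R) :
  V `<=` U -> Ck r U f -> Ck r V f.
Proof. by move=> VU Uf; apply: Ck_local => x /VU Ux; exists U. Qed.

Lemma Ck_sum (R : realType) (n r : nat) (U : set 'rV[R]_n) (I : Type)
    (s : seq I) (F : I -> 'rV[R]_n -> R) :
  open U -> (forall i, Ck r U (F i)) ->
  Ck r U (fun x => \sum_(i <- s) F i x).
Proof.
move=> oU CF; elim: s => [|i s IH].
  by apply: eq_Ck (Ck_cst r U 0) => // x _; rewrite big_nil.
by apply: eq_Ck (CkD oU (CF i) IH) => // x _; rewrite big_cons.
Qed.

Lemma Ck_prod (R : realType) (n r : nat) (U : set 'rV[R]_n) (I : Type)
    (s : seq I) (F : I -> 'rV[R]_n -> R) :
  open U -> (forall i, Ck r U (F i)) ->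
  Ck r U (fun x => \prod_(i <- s) F i x).
Proof.
move=> oU CF; elim: s => [|i s IH].
  by apply: eq_Ck (Ck_cst r U 1) => // x _; rewrite big_nil.
by apply: eq_Ck (CkM oU (CF i) IH) => // x _; rewrite big_cons.
Qed.

Lemma CkV (R : realType) (n r : nat) (U : set 'rV[R]_n)
    (f : 'rV[R]_n -> R) :
  open U -> (forall x, U x -> f x != 0) -> Ck r U f ->
  Ck r U (fun x => (f x)^-1).
Proof.
move=> oU f0; elim: r => [|r IH] Cf.
all: have [cf df] := Cf; split=> //; try by
  move=> x Ux; apply: continuousV; [exact: f0|exact: cf].
have CV := IH (CkS Cf) => i; have [df1 df2] := df i; split=> [x Ux|].
  by apply: derivableV; [exact: f0|exact: df1].
apply: (eq_Ck oU)
  (CkM oU (CkM oU (Ck_cst r U (-1)) (CkM oU CV CV)) df2) => x Ux.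
rewrite (deriveV (f0 _ Ux) (df1 _ Ux)).
have mE (a b c : R) : -1 * (a * b) * c = - (a * b) * c by rewrite mulN1r.
by rewrite -exprVn expr2; exact: mE.
Qed.

Lemma Ck_det (R : realType) (n r k : nat) (U : set 'rV[R]_n)
    (A : 'rV[R]_n -> 'M[R]_k) :
  open U -> (forall i j, Ck r U (fun x => A x i j)) ->
  Ck r U (fun x => \det (A x)).
Proof.
move=> oU CA; rewrite /determinant; apply: Ck_sum => // s.
have Cprod : Ck r U (fun x => \prod_i A x i (s i)).
  by apply: Ck_prod => // i; exact: CA.
by apply: (eq_Ck oU) (CkM oU (Ck_cst r U ((-1) ^+ s)) Cprod).
Qed.

Lemma Ck_adj (R : realType) (n r k : nat) (U : set 'rV[R]_n)
    (A : 'rV[R]_n -> 'M[R]_k) :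
  open U -> (forall i j, Ck r U (fun x => A x i j)) ->
  forall i j, Ck r U (fun x => (\adj (A x)) i j).
Proof.
move=> oU CA i j.
apply: (eq_Ck oU) (CkM oU (Ck_cst r U ((-1) ^+ (j + i)))
  (@Ck_det _ _ r _ U (fun x => row' j (col' i (A x))) oU _)) => [x _|a b].
  by rewrite mxE.
by apply: (eq_Ck oU) (CA (lift j a) (lift i b)) => x _; rewrite !mxE.
Qed.

(** Cramer's rule: the solution of a linear system with C^r coefficients, C^r
    right-hand side and nonvanishing determinant is C^r. *)
Lemma Ck_solve (R : realType) (n r k : nat) (U : set 'rV[R]_n)
    (A : 'rV[R]_n -> 'M[R]_k) (y : 'rV[R]_n -> 'rV[R]_k) :
  open U -> (forall x, U x -> \det (A x) != 0) ->
  (forall i j, Ck r U (fun x => A x i j)) ->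
  (forall j, Ck r U (fun x => (y x *m A x) 0 j)) ->
  forall i, Ck r U (fun x => y x 0 i).
Proof.
move=> oU dA CA Cb i.
apply: (eq_Ck oU) (CkM oU (CkV oU dA (Ck_det oU CA))
  (@Ck_sum _ _ r U _ (index_enum 'I_k) _ oU
     (fun j => CkM oU (Cb j) (Ck_adj oU CA j i)))) => x Ux.
rewrite /GRing.mul /=.
have <- : (y x *m A x *m \adj (A x)) 0 i =
   \sum_j (y x *m A x) 0 j * \adj (A x) j i by rewrite mxE.
by rewrite -mulmxA mul_mx_adj mul_mx_scalar mxE mulKf // dA.
Qed.

(** * Linear algebra *)

(** Finitely many independent functions on a set are already independent on as
    many well-chosen points. *)
Lemma lin_indep_det (R : realType) (S : Type) (k : nat)
    (e : 'I_k -> S -> R) :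
  (forall a : 'I_k -> R, (forall s, \sum_i a i * e i s = 0) ->
     forall i, a i = 0) ->
  exists s : 'I_k -> S, \det (\matrix_(i, j) e i (s j)) != 0.
Proof.
elim: k e => [|k IH] e free.
  have s (i : 'I_0) : S by case: i.
  by exists s; rewrite det_mx00 oner_neq0.
have [a a0|s ds] := IH (fun i => e (lift ord0 i)).
  (* A relation among the last k functions, padded with a zero. *)
  pose b i := if unlift ord0 i is Some j then a j else 0.
  move=> i; have := free b _ (lift ord0 i); rewrite /b liftK; apply=> s.
  rewrite big_ord_recl unlift_none mul0r add0r -[RHS](a0 s).
  by apply: eq_bigr => j _; rewrite liftK.
apply: contrapT => noS; case/negP: ds; apply/eqP.
(* The points s serve all functions but the first.  A point t is added as
   column 0, along which the determinant expands as a combination of the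
   e i t.  The coefficient of e ord0 t is the determinant for s; it vanishes
   if the expansion does for every t. *)
pose col t (j : 'I_k.+1) := if unlift ord0 j is Some l then s l else t.
pose A t := \matrix_(i, j) e i (col t j).
pose C (i : 'I_k.+1) :=
  (-1) ^+ (i + 0) * \det (\matrix_(a, b) e (lift i a) (s b)).
have detA t : \det (A t) = \sum_i C i * e i t.
  rewrite (expand_det_col _ ord0); apply: eq_bigr => i _.
  rewrite mulrC; congr (_ * _); last by rewrite mxE /col unlift_none.
  rewrite /cofactor /C; congr (_ * \det _).
  by apply/matrixP => a b; rewrite !mxE /col liftK.
have := free C _ ord0; rewrite /C addn0 expr0 mul1r; apply=> t.
rewrite -detA; apply: contrapT => /eqP dt.
by apply: noS; exists (col t).
Qed.

(** In a space with a basis of [k] vectors, [k] independent vectors span. *)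
Lemma lin_indep_basis (R : realType) (V : lmodType R) (k : nat) (W : set V)
    (e x : 'I_k -> V) :
  basis_of_set W e -> lin_indep x -> (forall i, W (x i)) -> basis_of_set W x.
Proof.
move=> [_ defW] free Wx; split=> //.
have /choice[b xE] : forall i, exists b : 'I_k -> R, x i = \sum_j b j *: e j.
  by move=> i; have := Wx i; rewrite defW.
pose B := \matrix_(i, j) b i j.
have combE (a : 'rV[R]_k) :
    \sum_i a 0 i *: x i = \sum_j (a *m B) 0 j *: e j.
  under eq_bigr do rewrite xE scaler_sumr.
  rewrite exchange_big; apply: eq_bigr => j _ /=.
  rewrite mxE scaler_suml; apply: eq_bigr => i _.
  by rewrite scalerA mxE.
(* A row in the kernel of B is a relation among the x i. *)
have uB : B \in unitmx.
  rewrite -row_free_unit -kermx_eq0; apply/eqP/row_matrixP => i; rewrite row0.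
  apply/rowP => j; rewrite [RHS]mxE; move: j.
  apply: free; rewrite combE -row_mul mulmx_ker row0.
  by apply: big1 => j _; rewrite mxE scale0r.
rewrite defW; apply/seteqP; split=> v /= [a ->].
  exists (fun i => ((\row_j a j) *m invmx B) 0 i).
  by rewrite combE mulmxKV //; apply: eq_bigr => j _; rewrite mxE.
exists (fun j => ((\row_i a i) *m B) 0 j).
by rewrite -combE; apply: eq_bigr => i _; rewrite mxE.
Qed.

(** [W] is a subspace because it has a basis; outside [W] nothing is known
    of [w]. *)
Lemma linear_on_sum (R : realType) (V : lmodType R) (k : nat) (W : set V)
    (x : 'I_k -> V) (w : V -> R) (a : 'I_k -> R) :
  basis_of_set W x -> linear_on W w ->
  w (\sum_i a i *: x i) = \sum_i a i * w (x i).
Proof.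
move=> [_ defW] lw.
have W0 : W 0.
  by rewrite defW; exists (fun=> 0); rewrite big1 // => i _; rewrite scale0r.
have Wx i : W (x i).
  rewrite defW; exists (fun j => (j == i)%:R).
  rewrite (bigD1 i) //= eqxx scale1r big1 ?addr0 // => j /negPf->.
  by rewrite scale0r.
have WD b u v : W u -> W v -> W (b *: u + v).
  rewrite defW => -[c ->] [d ->]; exists (fun i => b * c i + d i).
  rewrite scaler_sumr -big_split; apply: eq_bigr => i _ /=.
  by rewrite scalerDl scalerA.
have w0 : w 0 = 0.
  by have := lw (-1) 0 0 W0 W0; rewrite scaler0 addr0 mulN1r addNr.
have [] // : W (\sum_i a i *: x i) /\
    w (\sum_i a i *: x i) = \sum_i a i * w (x i).
apply: (big_rec2 (fun u t => W u /\ w u = t)) => // i t u _ [Wu wu].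
by split; [exact: WD|rewrite lw // wu].
Qed.

(** * The metric of a parallelization *)

Section ParallelizationMetric.
Variables (R : realType) (n : nat) (M : manifold R n) (k : nat).
Variables (D : fiber_family M) (X : 'I_k -> vfield M).
Variable Omega : 'I_k -> M -> tvec M -> R.
Hypothesis rankD : rank_distribution k D.
Hypothesis parX : parallelization D X.
Hypothesis formsX : parallelization_forms D X Omega.

Lemma parallelization_basis p : basis_of_set (D p) (fun i => X i p).
Proof.
have [e eD] := (rankD.1 p).2.
apply: lin_indep_basis eD (parX.2 p) _ => i.
by have [_] := parX.1 i; apply.
Qed.

Lemma parallelization_formE p (a : 'I_k -> R) i :
  Omega i p (\sum_j a j *: X j p) = a i.
Proof.
have [lO dO] := formsX i p.
rewrite (linear_on_sum _ (parallelization_basis p) lO) (bigD1 i) //=.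
rewrite dO eqxx mulr1 big1 ?addr0 // => j /negPf ji.
by rewrite dO eq_sym ji mulr0.
Qed.

Lemma parallelization_decomp p v :
  D p v -> v = \sum_i Omega i p v *: X i p.
Proof.
have [_ ->] := parallelization_basis p; move=> /= [a ->].
by apply: eq_bigr => i _; rewrite parallelization_formE.
Qed.

Lemma sum_tensor_sq_inner p : inner_product_on (D p) (sum_tensor_sq Omega p).
Proof.
split=> [v _ a u w Du Dw|u v _ _|u Du u0]; rewrite /sum_tensor_sq.
- rewrite mulr_sumr -big_split; apply: eq_bigr => i _ /=.
  by rewrite (formsX i p).1 // mulrDl mulrA.
- by apply: eq_bigr => i _; rewrite mulrC.
have ge0 i : true -> 0 <= Omega i p u * Omega i p u.
  by rewrite -expr2 sqr_ge0.
rewrite lt_neqAle sumr_ge0 // andbT eq_sym; apply/eqP => /eqP.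
rewrite psumr_eq0 // => /allP O0; apply: u0.
rewrite (parallelization_decomp Du) big1 // => i _.
have /O0 : i \in index_enum 'I_k by rewrite mem_index_enum.
by rewrite /= mulf_eq0 orbb => /eqP->; rewrite scale0r.
Qed.

(** The parallelization forms are smooth: they send smooth local sections to
    smooth functions. *)
Lemma smooth_parallelization_form (U : set M) (Y : vfield M) i :
  open U -> sections_on U D Y -> smooth_on U (fun p => Omega i p (Y p)).
Proof.
move=> oU [[_ sY] DY] c ac r.
have oW := @chart_open _ _ M c U oU; set W := cmap c @` _ in oW *.
have CX j f : Ck r W (fun x => X j (cinv c x) f).
  have [[_ sX] _] := parX.1 j.
  apply: Ck_subset (sX f c ac r).
  by move=> _ [p [cp _] <-]; exists p.
apply: Ck_local => x0 Wx0.
have [s ds] : exists s : 'I_k -> Cinf M,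
    \det (\matrix_(j, l) X j (cinv c x0) (s l)) != 0.
  apply: (lin_indep_det (e := fun j => X j (cinv c x0))) => a a0.
  apply: (parX.2 (cinv c x0) a).
  apply/funext => f; rewrite -[RHS](a0 f).
  by elim/big_rec2: _ => // j y v _ <-.
pose A x := \matrix_(j, l) X j (cinv c x) (s l).
have CA j l : Ck r W (fun x => A x j l).
  by apply: (eq_Ck oW) (CX j (s l)) => x _; rewrite mxE.
pose V := W `&` [set x | \det (A x) != 0].
have oV : open V.
  rewrite openE => x [Wx dx]; apply: filterI; first exact: open_nbhs_nbhs.
  have cd : {for x, continuous (fun z => \det (A z))}.
    exact: (Ck_cont (Ck_det oW CA) Wx).
  apply: (cd [set d | d != 0]).
  by apply: open_nbhs_nbhs; split=> //; exact: open_neq.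
exists V; first by split.
have VW : V `<=` W by move=> x [].
pose y x : 'rV[R]_k := \row_j Omega j (cinv c x) (Y (cinv c x)).
apply: (eq_Ck oV) (@Ck_solve _ _ r _ V A y oV _ _ _ i) => [x _|x []||l] //.
- by rewrite mxE.
- by move=> j l; apply: Ck_subset (CA j l).
apply: (eq_Ck oV) (Ck_subset VW (sY (s l) c ac r)) => x /VW [p [cp Up] <-].
rewrite /= cmapK // [in LHS](parallelization_decomp (DY _ Up)) mxE.
under [RHS]eq_bigr do rewrite !mxE cmapK //.
by elim/big_rec2: _ => // j z v _ <-.
Qed.

Lemma sum_tensor_sq_metric : sub_riemannian_metric D (sum_tensor_sq Omega).
Proof.
split=> [p|U Y Z oU sY sZ c ac r]; first exact: sum_tensor_sq_inner.
have oW := @chart_open _ _ M c U oU.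
apply: Ck_sum => // i.
have CY := smooth_parallelization_form i oU sY ac r.
have CZ := smooth_parallelization_form i oU sZ ac r.
by apply: (eq_Ck oW) (CkM oW CY CZ).
Qed.

End ParallelizationMetric.

Theorem corollary2p8 (R : realType) (n : nat) (M : manifold R n) (k : nat)
    (HM : fiber_family M) (X : 'I_k -> vfield M)
    (Omega : 'I_k -> M -> tvec M -> R) :
  (k < n)%N ->
  rank_distribution k HM ->
  parallelization HM X ->
  parallelization_forms HM X Omega ->
  let g := sum_tensor_sq Omega in
  (nonintegrable k HM ->
     sub_riemannian_structure (nonintegrable k) k HM g) /\
  (bracket_generating HM ->
     sub_riemannian_structure (@bracket_generating R n M) k HM g).
Proof.
move=> _ rankHM parX formsX g.
have metric : sub_riemannian_metric HM g by exact: sum_tensor_sq_metric formsX.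
by split=> ?; split.
Qed.
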